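(* Let $\mathbf{x}_1,\dots,\mathbf{x}_r\in\mathbb{R}^d$ be fixed design points, $\mathbb{C}\subseteq\mathbb{R}^r$ the set of convex vectors on these points, and consider the Bayesian model in the context (known or unknown covariance). For $n\ge 0$ and $\ell\ge 1$, let $\phi_n$ and $\phi_{n+\ell}$ denote the posterior (marginal) densities of $\mathbf{F}\mid\mathscr{A}_n$ and $\mathbf{F}\mid\mathscr{A}_{n+\ell}$, and let $L_{n+\ell,n}(\mathbf{y})=\phi_{n+\ell}(\mathbf{y})/\phi_n(\mathbf{y})$. Let $\mathbf{Y}_n$ be a sample drawn from the density $\phi_n$ (independently of the observations $\mathbf{Y}_{n+1},\dots,\mathbf{Y}_{n+\ell}$ given $\mathscr{A}_n$). Then the estimator $\hat p_{n+\ell}=\mathbf{1}\{\mathbf{Y}_n\in\mathbb{C}\}\,L_{n+\ell,n}(\mathbf{Y}_n)$ satisfies, conditional on $\mathscr{A}_{n+\ell}$, $E[\hat p_{n+\ell}\mid\mathscr{A}_{n+\ell}]=P(\mathbf{F}\in\mathbb{C}\mid\mathscr{A}_{n+\ell})$ and $\mathrm{Var}(\hat p_{n+\ell}\mid\mathscr{A}_{n+\ell})<\infty$.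
   Context: A vector $\mathbf{g}\in\mathbb{R}^r$ is called convex (on $\mathbf{x}_1,\dots,\mathbf{x}_r$) if there exists a convex function $f:\mathbb{R}^d\to\mathbb{R}$ with $f(\mathbf{x}_i)=g_i$ for $i=1,\dots,r$; $\mathbb{C}$ denotes the set of all such vectors. Bayesian model: $\mathbf{F}$ is an $\mathbb{R}^r$-valued random vector drawn from a prior; observations are $\mathbf{Y}_j=\mathbf{F}+\boldsymbol{\xi}_j$, $j=1,2,\dots$, with $\boldsymbol{\xi}_j$ i.i.d. $N(\mathbf{0},\Gamma)$ independent of $\mathbf{F}$, $\Gamma$ positive definite. $\mathscr{A}_n$ is the $\sigma$-field generated by the initial information $\mathscr{A}_0$ and $\mathbf{Y}_1,\dots,\mathbf{Y}_n$. Known-covariance model: $\Gamma$ known, prior $\mathbf{F}\sim N(\boldsymbol{\mu}_0,\Lambda_0)$ with $\Lambda_0$ positive definite, posterior $N(\boldsymbol{\mu}_n,\Lambda_n)$ with $\Lambda_n^{-1}=\Lambda_{n-1}^{-1}+\Gamma^{-1}$, $\boldsymbol{\mu}_n=\Lambda_n(\Lambda_{n-1}^{-1}\boldsymbol{\mu}_{n-1}+\Gamma^{-1}\mathbf{Y}_n)$. Unknown-covariance model: normal–inverse-Wishart prior $\Gamma\sim\text{Inv-Wishart}_{\upsilon_0}(\Xi_0^{-1})$, $\mathbf{F}\mid\Gamma\sim N(\boldsymbol{\mu}_0,\Gamma/\kappa_0)$, with updates $\boldsymbol{\mu}_n=\frac{\kappa_{n-1}\boldsymbol{\mu}_{n-1}+\mathbf{Y}_n}{\kappa_{n-1}+1}$,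 $\kappa_n=\kappa_{n-1}+1$, $\upsilon_n=\upsilon_{n-1}+1$, $\Xi_n=\Xi_{n-1}+\frac{\kappa_{n-1}}{\kappa_{n-1}+1}(\mathbf{Y}_n-\boldsymbol{\mu}_{n-1})(\mathbf{Y}_n-\boldsymbol{\mu}_{n-1})^T$; the marginal posterior density of $\mathbf{F}$ is multivariate Student-$t$ with $\upsilon_n-r+1$ degrees of freedom, location $\boldsymbol{\mu}_n$ and scale matrix $\Xi_n/(\kappa_n(\upsilon_n-r+1))$. *)

(* Defs.v *)
From HB Require Import structures.
From mathcomp Require Import all_boot all_order all_algebra.
From mathcomp Require Import all_classical all_reals all_analysis.
Set Implicit Arguments. Unset Strict Implicit. Unset Printing Implicit Defensive.
Import Order.TTheory GRing.Theory Num.Theory.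
Import numFieldNormedType.Exports.
Local Open Scope classical_set_scope.
Local Open Scope ring_scope.

Definition convex_fn {R : realType} {d : nat} (f : 'cV[R]_d -> R) : Prop :=
  forall (a b : 'cV[R]_d) (t : R), 0 <= t -> t <= 1 ->
    f (t *: a + (1 - t) *: b) <= t * f a + (1 - t) * f b.

Definition convex_vectors {R : realType} {d r : nat} (x : 'I_r -> 'cV[R]_d)
  : set 'cV[R]_r :=
  [set g | exists f : 'cV[R]_d -> R, convex_fn f /\ forall i, f (x i) = g i ord0].

Definition posdef {R : realType} {r : nat} (A : 'M[R]_r) : Prop :=
  A^T = A /\ forall v : 'cV[R]_r, v != 0 -> 0 < (v^T *m A *m v) ord0 ord0.

Definition mahal {R : realType} {r : nat} (S : 'M[R]_r) (m y : 'cV[R]_r) : R :=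
  ((y - m)^T *m invmx S *m (y - m)) ord0 ord0.

Definition gauss_pdf {R : realType} {r : nat} (m : 'cV[R]_r) (S : 'M[R]_r)
  (y : 'cV[R]_r) : R :=
  powR (pi *+ 2) (- (r%:R / 2)) * (Num.sqrt (\det S))^-1
  * expR (- (mahal S m y / 2)).

Definition gammaf {R : realType} (a : R) : R :=
  fine (\int[lebesgue_measure]_(t in `]0%R, +oo[%classic)
          (powR t (a - 1) * expR (- t))%:E)%E.

Definition student_pdf {R : realType} {r : nat} (nu : R) (m : 'cV[R]_r)
  (S : 'M[R]_r) (y : 'cV[R]_r) : R :=
  gammaf ((nu + r%:R) / 2)
  / (gammaf (nu / 2) * powR (nu * pi) (r%:R / 2) * Num.sqrt (\det S))
  * powR (1 + mahal S m y / nu) (- ((nu + r%:R) / 2)).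

(** Lebesgue integral over R^r of a function into \bar R, written as the
    iterated integral w.r.t. the one-dimensional Lebesgue measure
    (by Tonelli this is the Lebesgue integral on R^r for nonnegative
    measurable integrands, which is the only way it is used). *)
Definition ccons {R : realType} {n : nat} (a : R) (v : 'cV[R]_n) : 'cV[R]_n.+1 :=
  \col_i oapp (fun j => v j ord0) a (unlift ord0 i).

Fixpoint iint (R : realType) (n : nat) {struct n} :
    ('cV[R]_n -> \bar R) -> \bar R :=
  match n with
  | 0 => fun f => f 0
  | n'.+1 => fun f =>
      (\int[@lebesgue_measure R]_(a in [set: R]) iint (fun v => f (ccons a v)))%E
  end.

(** Known-covariance model: posterior (Lambda_k, mu_k) after k observations
    y 1, ..., y k  (y 0 is unused). *)
Fixpoint post_known {R : realType} {r : nat} (Gam Lam0 : 'M[R]_r)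
  (mu0 : 'cV[R]_r) (y : nat -> 'cV[R]_r) (k : nat) : 'M[R]_r * 'cV[R]_r :=
  match k with
  | 0 => (Lam0, mu0)
  | k'.+1 =>
      let '(Lp, mp) := post_known Gam Lam0 mu0 y k' in
      let L := invmx (invmx Lp + invmx Gam) in
      (L, L *m (invmx Lp *m mp + invmx Gam *m y k))
  end.

Definition known_post_pdf {R : realType} {r : nat} (Gam Lam0 : 'M[R]_r)
  (mu0 : 'cV[R]_r) (y : nat -> 'cV[R]_r) (k : nat) : 'cV[R]_r -> R :=
  gauss_pdf (post_known Gam Lam0 mu0 y k).2 (post_known Gam Lam0 mu0 y k).1.

(** Unknown-covariance model (normal-inverse-Wishart):
    posterior (mu_k, kappa_k, upsilon_k, Xi_k). *)
Fixpoint post_niw {R : realType} {r : nat} (mu0 : 'cV[R]_r) (kap0 ups0 : R)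
  (Xi0 : 'M[R]_r) (y : nat -> 'cV[R]_r) (k : nat)
  : 'cV[R]_r * R * R * 'M[R]_r :=
  match k with
  | 0 => (mu0, kap0, ups0, Xi0)
  | k'.+1 =>
      let '(mp, kp, up, Xp) := post_niw mu0 kap0 ups0 Xi0 y k' in
      ((kp + 1)^-1 *: (kp *: mp + y k), kp + 1, up + 1,
       Xp + (kp / (kp + 1)) *: ((y k - mp) *m (y k - mp)^T))
  end.

(** Marginal posterior density of F: multivariate Student-t with
    upsilon_k - r + 1 dof, location mu_k, scale Xi_k/(kappa_k (upsilon_k - r + 1)). *)
Definition niw_post_pdf {R : realType} {r : nat} (mu0 : 'cV[R]_r) (kap0 ups0 : R)
  (Xi0 : 'M[R]_r) (y : nat -> 'cV[R]_r) (k : nat) : 'cV[R]_r -> R :=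
  let '(m, ka, up, X) := post_niw mu0 kap0 ups0 Xi0 y k in
  let nu := up - r%:R + 1 in
  student_pdf nu m ((ka * nu)^-1 *: X).

Definition phat {R : realType} {r : nat} (C : set 'cV[R]_r)
  (phi_n phi_nl : 'cV[R]_r -> R) (v : 'cV[R]_r) : R :=
  (\1_C v : R) * (phi_nl v / phi_n v).

(** E[p_hat | A_{n+l}]: expectation over v ~ phi_n, data fixed. *)
Definition is_mean {R : realType} {r : nat} (C : set 'cV[R]_r)
  (phi_n phi_nl : 'cV[R]_r -> R) : \bar R :=
  iint (fun v => (phat C phi_n phi_nl v * phi_n v)%:E).

Definition is_var {R : realType} {r : nat} (C : set 'cV[R]_r)
  (phi_n phi_nl : 'cV[R]_r -> R) : \bar R :=
  iint (fun v => (((phat C phi_n phi_nl v)%:E - is_mean C phi_n phi_nl) ^+ 2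
                  * (phi_n v)%:E)%E).

Definition post_prob {R : realType} {r : nat} (C : set 'cV[R]_r)
  (phi : 'cV[R]_r -> R) : \bar R :=
  iint (fun v => ((\1_C v : R) * phi v)%:E).

(* Main.v *)
(** Both posterior densities are everywhere positive, so the weight cancels
    pointwise and the mean identity is immediate. For the variance it suffices
    that [phi_n], [phi_{n+l}] and [phi_{n+l}^2 / phi_n] are all bounded by
    [K (1 + |v|^2)^(-s)] with [s > r/2], which is in turn dominated by an
    integrable product of functions of one coordinate. In the Gaussian case
    the exponent of the ratio stays negative definite because the precision
    matrix can only grow with the data; in the Student case all densities are
    comparable to powers of [1 + |v|^2] and the number of degrees of freedom
    can only grow. *)

Require Import Defs.
From HB Require Import structures.
From mathcomp Require Import all_boot all_order all_algebra.
From mathcomp Require Import all_classical all_reals all_analysis.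
From mathcomp Require Import measurable_realfun ring lra.
From mathcomp Require polyrcf.
Import Order.TTheory GRing.Theory Num.Theory.
Import numFieldNormedType.Exports.
Local Open Scope classical_set_scope.
Local Open Scope ring_scope.

Set Implicit Arguments.
Unset Strict Implicit.
Unset Printing Implicit Defensive.

(** * Integrals of nonnegative functions, on the line and iterated *)

(* No measurability is required: the integral of a nonnegative function is a
   supremum over the simple functions below it. This is what spares us the
   measurability of the set of convex vectors. *)
Lemma le_integral_dominated (d : measure_display) (T : measurableType d)
  (R : realType) (mu : {measure set T -> \bar R}) (D : set T)
  (f g : T -> \bar R) :
  (forall x, D x -> 0 <= f x)%E -> (forall x, D x -> f x <= g x)%E ->
  (\int[mu]_(x in D) f x <= \int[mu]_(x in D) g x)%E.
Proof.
move=> f0 fg; have g0 x : D x -> (0 <= g x)%E.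
  by move=> Dx; exact: le_trans (f0 _ Dx) (fg _ Dx).
rewrite !ge0_integralE//; apply: le_ereal_sup => _ [h /= hf <-].
exists h => // x; apply: le_trans (hf x) _.
by rewrite /patch; case: ifPn => // /set_mem /fg.
Qed.

Lemma eq_iint (R : realType) n (f g : 'cV[R]_n -> \bar R) :
  f =1 g -> iint f = iint g.
Proof. by move=> /funext ->. Qed.

Lemma iint_ge0 (R : realType) n (f : 'cV[R]_n -> \bar R) :
  (forall v, 0 <= f v)%E -> (0 <= iint f)%E.
Proof.
elim: n f => [|n IH] f f0 //=.
by apply: integral_ge0 => a _; exact: IH.
Qed.

Lemma le_iint (R : realType) n (f g : 'cV[R]_n -> \bar R) :
  (forall v, 0 <= f v)%E -> (forall v, f v <= g v)%E ->
  (iint f <= iint g)%E.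
Proof.
elim: n f g => [|n IH] f g f0 fg //=.
by apply: le_integral_dominated => a _; [exact: iint_ge0|exact: IH].
Qed.

(** Induction on [n] with [K] generalised: the factor [h a] of the outermost coordinate is absorbed
    into the constant of the inner integral. *)
Lemma iint_prod (R : realType) (h : R -> R) (I : R) n (K : R) :
  (forall t, 0 <= h t) -> measurable_fun setT h ->
  (\int[@lebesgue_measure R]_t (h t)%:E = I%:E)%E -> 0 <= K ->
  iint (fun v : 'cV[R]_n => (K * \prod_(i < n) h (v i ord0))%:E)
    = (K * I ^+ n)%:E.
Proof.
move=> h0 mh hI; elim: n K => [|n IH] K K0 /=.
  by rewrite big_ord0 expr0.
have I0 : 0 <= I by rewrite -lee_fin -hI; apply: integral_ge0 => t _; rewrite lee_fin.
have step a : iint (fun v : 'cV[R]_n =>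
      (K * \prod_(i < n.+1) h (ccons a v i ord0))%:E)
    = ((h a)%:E * (K * I ^+ n)%:E)%E.
  rewrite -EFinM mulrA (mulrC (h a)) -IH ?mulr_ge0//; apply: eq_iint => v.
  rewrite big_ord_recl mulrA mxE unlift_none /=; congr (_ * _)%:E.
  by apply: eq_bigr => i _; rewrite mxE liftK.
under eq_integral do rewrite step.
rewrite ge0_integralZr//; first 1 last.
- by apply/measurable_EFinP.
- by move=> t _; rewrite lee_fin.
- by rewrite lee_fin mulr_ge0// exprn_ge0.
by rewrite hI -EFinM exprS; congr EFin; ring.
Qed.

(** * Improper integrals on the line *)

(** The half-line is exhausted by compact intervals, where the fundamental theorem of calculus gives
    a difference of values of [G]; monotone convergence concludes. Nothing is asked at 0, so [f] may
    be singular there. *)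
Lemma integral_le_antiderivative_bound (R : realType) (f G : R -> R) (M : R) :
  (forall t : R, 0 < t -> 0 <= f t) -> (forall t : R, 0 < t -> {for t, continuous f}) ->
  (forall t : R, 0 < t -> is_derive t (1 : R) G (f t)) ->
  (forall t : R, 0 < t -> 0 <= G t <= M) ->
  (\int[@lebesgue_measure R]_(t in `]0%R, +oo[) (f t)%:E <= M%:E)%E.
Proof.
move=> f0 cf dG GM.
(* Starting from 2 keeps the endpoints strictly ordered even for [n = 0]. *)
pose F n : set R := `[(n.+2%:R)^-1, n.+2%:R]%classic.
have Fgt0 n x : F n x -> 0 < x.
  by rewrite /F/= in_itv/= => /andP[+ _]; apply: lt_le_trans; rewrite invr_gt0.
have FU : \bigcup_n F n = `]0%R, +oo[%classic.
  apply/seteqP; split=> [x [n _ /Fgt0]|x]; rewrite /= in_itv/= andbT// => x0.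
  have [n nx] : exists n, Num.max x x^-1 < n%:R.
    by exists (Num.bound (Num.max x x^-1)); rewrite archi_boundP// le_max ltW.
  exists n => //; rewrite /F/= in_itv/=; move: nx; rewrite gt_max => /andP[n1 n2].
  have nn : n%:R <= n.+2%:R :> R by rewrite ler_nat -addn2 leq_addr.
  by rewrite invf_ple ?posrE// !ltW ?(lt_le_trans _ nn).
have cF n : {within F n, continuous f}.
  apply: continuous_in_subspaceT => x /set_mem /Fgt0; exact: cf.
have cv : (\int[@lebesgue_measure R]_(x in F i) (f x)%:E)%E @[i --> \oo] -->
    (\int[@lebesgue_measure R]_(t in `]0%R, +oo[) (f t)%:E)%E.
  rewrite -FU; apply: ge0_nondecreasing_set_cvg_integral => //.
  - apply/nondecreasing_seqP => n; apply/subsetPset => x.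
    rewrite /F/= !in_itv/= => /andP[h1 h2]; apply/andP; split.
      by apply: le_trans h1; rewrite lef_pV2 ?posrE// ler_nat.
    by apply: le_trans h2 _; rewrite ler_nat.
  - by move=> i; exact: measurable_itv.
  - move=> i; apply/measurable_EFinP; apply: subspace_continuous_measurable_fun => //.
    exact: measurable_itv.
  - by move=> i x /Fgt0 /f0; rewrite lee_fin.
have cG (t : R) : 0 < t -> {for t, continuous G}.
  move=> /dG dGt; apply: differentiable_continuous; apply/derivable1_diffP.
  by apply: ex_derive.
rewrite -(cvg_lim _ cv)//; apply: lime_le; first by apply/cvg_ex; eexists; exact: cv.
apply: nearW => n.
have n0 : 0 < (n.+2%:R : R)^-1 by rewrite invr_gt0.
have lt1 : (n.+2%:R : R)^-1 < n.+2%:R.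
  by rewrite (@lt_trans _ _ 1)// ?invf_lt1// ltr1n.
rewrite (@continuous_FTC2 _ f G)//.
- rewrite -EFinB lee_fin.
  have /andP[+ _] := GM _ n0; have /andP[_] : 0 <= G n.+2%:R <= M by apply: GM.
  lra.
- exact: cF.
- split.
  + move=> x; rewrite in_itv/= => /andP[+ _] => /(lt_trans n0) /dG ?; exact: ex_derive.
  + by apply: cvg_at_right_filter; exact: cG.
  + by apply: cvg_at_left_filter; apply: cG.
- move=> x; rewrite in_itv/= => /andP[+ _] => /(lt_trans n0) /dG ?.
  by rewrite derive1E derive_val.
Qed.

Lemma is_derive1_continuous (R : realType) (f : R -> R) (t df : R) :
  is_derive t (1 : R) f df -> {for t, continuous f}.
Proof.
move=> ft; apply: differentiable_continuous; apply/derivable1_diffP.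
exact: ex_derive.
Qed.

Lemma is_derive1_powR_comp (R : realType) (g : R -> R) (t b p : R) :
  0 < g t -> is_derive t (1 : R) g b ->
  is_derive t (1 : R) (fun t => g t `^ p) (p * g t `^ (p - 1) * b).
Proof.
by move=> gt dg; exact: (is_derive1_comp (is_derive1_powR p gt) dg).
Qed.

Lemma continuous_powR_oneDsqr (R : realType) (p : R) :
  continuous (fun t : R => (1 + t ^+ 2) `^ (- p)).
Proof.
move=> t; apply: (@is_derive1_continuous _ _ _ _); apply: is_derive1_powR_comp.
by have := sqr_ge0 t; lra.
Qed.

(** By symmetry the half-line suffices. There [(1 + t)^2 <= 2 (1 + t^2)] bounds the integrand by
    [2^p (1 + t)^(-2p)], whose antiderivative is bounded because [2p > 1]. *)
Lemma integral_powR_oneDsqr_finite (R : realType) (p : R) : 2^-1 < p ->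
  exists I : R, (\int[@lebesgue_measure R]_t
    (((1 + t ^+ 2) `^ (- p))%:E) = I%:E)%E.
Proof.
move=> p12.
have h0 t : 0 <= (1 + t ^+ 2) `^ (- p) by exact: powR_ge0.
have ch := @continuous_powR_oneDsqr _ p.
suff: (\int[@lebesgue_measure R]_t (((1 + t ^+ 2) `^ (- p))%:E) < +oo)%E.
  set J := integral _ _ _ => fin; exists (fine J); rewrite fineK// ge0_fin_numE//.
  by apply: integral_ge0 => t _; rewrite lee_fin.
rewrite ge0_symfun_integralT//; last by move=> t /=; rewrite sqrrN.
have mh : measurable_fun setT (fun t : R => (1 + t ^+ 2) `^ (- p)).
  exact: continuous_measurable_fun.
rewrite -set_itvcy -integral_itv_obnd_cbnd; last first.
  by apply/measurable_EFinP; exact: measurable_funTS.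
(* With these choices [f t] is exactly [2^p (1 + t)^(-2p)], and [G] is its antiderivative vanishing
   at 0. *)
pose a := 2 * p - 1; have a0 : 0 < a by rewrite /a; lra.
pose K := 2 `^ p / a : R; have K0 : 0 < K by rewrite divr_gt0// powR_gt0.
pose f (t : R) := K * (a * (1 + t) `^ (- a - 1)).
pose G (t : R) := K * (1 - (1 + t) `^ (- a)).
apply: (@le_lt_trans _ _ (2%:E * K%:E)%E); last by rewrite ltry.
rewrite lee_pmul2l//; apply: (@le_trans _ _
  (\int[@lebesgue_measure R]_(t in `]0%R, +oo[) (f t)%:E)%E).
  apply: le_integral_dominated => t; rewrite /= in_itv/= andbT => t0; rewrite lee_fin//.
  rewrite /f /K mulrA divfK ?gt_eqF// powRN -opprD powRN.
  have tp : 0 < 1 + t by lra.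
  have t2 : 0 < 1 + t ^+ 2 by have := sqr_ge0 t; lra.
  rewrite -[leLHS]div1r ler_pdivrMr ?powR_gt0// mulrAC ler_pdivlMr ?powR_gt0// mul1r.
  rewrite (_ : a + 1 = 2%:R * p) /a; last by ring.
  rewrite powRrM powR_mulrn ?(ltW tp)// -powRM ?(ltW t2)//.
  apply: (@ge0_ler_powR _ p); rewrite ?nnegrE; [lra|exact: sqr_ge0|lra|].
  by have := sqr_ge0 (t - 1); nra.
apply: (@integral_le_antiderivative_bound _ f G).
- by move=> t t0; rewrite /f mulr_ge0 ?(ltW K0)// mulr_ge0 ?(ltW a0)// powR_ge0.
- move=> t t0; have tp : 0 < 1 + t by lra.
  have dp : is_derive t (1 : R) (fun t => (1 + t) `^ (- a - 1))
      ((- a - 1) * (1 + t) `^ (- a - 1 - 1) * (0 + 1)).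
    by apply: is_derive1_powR_comp.
  have df := is_deriveZ K (is_deriveZ a dp).
  exact: (@is_derive1_continuous _ f t _ df).
- move=> t t0; have tp : 0 < 1 + t by lra.
  have dp : is_derive t (1 : R) (fun t => (1 + t) `^ (- a)) (- a * (1 + t) `^ (- a - 1) * (0 + 1)).
    by apply: is_derive1_powR_comp.
  have dc : is_derive t (1 : R) (cst (1 : R)) 0 by exact: is_derive_cst.
  have dG := is_deriveZ K (is_deriveB dc dp).
  apply: (@is_derive_eq _ _ _ G t 1 (f t) _ dG).
  by rewrite /GRing.scale/= /f; ring.
- move=> t t0; rewrite /G.
  have : (1 + t) `^ (- a) <= 1.
    by rewrite -[leRHS](powRr0 (1 + t)) ler_powR; lra.
  have := powR_ge0 (1 + t) (- a); set u := _ `^ _ => u0 u1.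
  by rewrite mulr_ge0 ?(ltW K0) ?subr_ge0//= ger_pMr// gerBl.
Qed.

(** * Powers against exponentials, and the Gamma function *)

(** Raise [1 + q <= (1 + s/e) (1 + (e/s) q) <= (1 + s/e) exp((e/s) q)] to the power [s]. *)
Lemma powR_le_expR (R : realType) (s e : R) : 0 < s -> 0 < e ->
  exists2 K : R, 0 < K & forall q : R, 0 <= q -> (1 + q) `^ s <= K * expR (e * q).
Proof.
move=> s0 e0; have c0 : 0 < 1 + s / e by rewrite ltr_pwDl// divr_ge0// ltW.
exists ((1 + s / e) `^ s) => [|q q0]; first by rewrite powR_gt0.
have -> : e * q = e / s * q * s by field; rewrite gt_eqF.
rewrite expRM -powRM ?expR_ge0 ?(ltW c0)//.
apply: ge0_ler_powR; rewrite ?nnegrE ?(ltW s0)//; first by lra.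
  by rewrite mulr_ge0 ?expR_ge0 ?(ltW c0).
apply: le_trans (ler_wpM2l (ltW c0) (expR_ge1Dx _)).
have -> : (1 + s / e) * (1 + e / s * q) = 1 + q + (e / s * q + s / e).
  by field; rewrite !gt_eqF.
by rewrite lerDl addr_ge0 ?mulr_ge0 ?invr_ge0 ?(ltW s0) ?(ltW e0).
Qed.

Lemma gammaf_integral_finite (R : realType) (a : R) : 0 < a ->
  (\int[@lebesgue_measure R]_(t in `]0%R, +oo[)
    (t `^ (a - 1) * expR (- t))%:E < +oo)%E.
Proof.
move=> a0; have h20 : 0 < 2^-1 :> R by rewrite invr_gt0.
(* In [C], the 1 pays for [1 <= exp(t/2)] and [D] for [t^a <= (1 + t)^a]. Squaring
   [1 + t^a <= C exp(t/2)] trades [exp(-t)] for [C^2 / (1 + t^a)^2]. *)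
have [D D0 DP] := powR_le_expR a0 h20; pose C := 1 + D.
have C0 : 0 < C by rewrite /C; lra.
have CP (t : R) : 0 < t -> 1 + t `^ a <= C * expR (t / 2).
  move=> t0; have := DP t (ltW t0); rewrite (mulrC 2^-1).
  have := expR_ge1Dx (t / 2); have : t `^ a <= (1 + t) `^ a.
    by apply: ge0_ler_powR; rewrite ?nnegrE; lra.
  by rewrite /C mulrDl; lra.
pose K := C ^+ 2 / a; have K0 : 0 < K by rewrite divr_gt0// exprn_gt0.
(* The dominating function is the derivative of the bounded
   [K (1 - 1 / (1 + t^a))]: it is integrable at both ends at once. *)
pose f (t : R) := K * (a * t `^ (a - 1) * ((1 + t `^ a)^-1 * (1 + t `^ a)^-1)).
pose G (t : R) := K * (1 - (1 + t `^ a)^-1).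
have pa (t : R) : 0 < 1 + t `^ a by have := powR_ge0 t a; lra.
have dpa (t : R) : 0 < t ->
    is_derive t (1 : R) (fun t => 1 + t `^ a) (0 + a * t `^ (a - 1)).
  by move=> t0; apply: is_deriveD; exact: is_derive1_powR.
have dV (t : R) : 0 < t -> is_derive t (1 : R) (fun t => (1 + t `^ a)^-1)
      (- (1 + t `^ a) ^- 2 *: (0 + a * t `^ (a - 1))).
  by move=> t0; apply: is_deriveV; [rewrite gt_eqF|exact: dpa].
apply: (@le_lt_trans _ _ K%:E); last by rewrite ltry.
apply: (@le_trans _ _
  (\int[@lebesgue_measure R]_(t in `]0%R, +oo[) (f t)%:E)%E).
  apply: le_integral_dominated => t; rewrite /= in_itv/= andbT => t0; rewrite lee_fin.
    by rewrite mulr_ge0 ?powR_ge0 ?expR_ge0.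
  rewrite /f /K mulrA (_ : C ^+ 2 / a * (a * t `^ (a - 1)) = t `^ (a - 1) * C ^+ 2); last first.
    by field; rewrite gt_eqF.
  rewrite -mulrA ler_wpM2l ?powR_ge0// -invfM -expr2 expRN ler_pdivlMr ?exprn_gt0//.
  rewrite mulrC ler_pdivrMr ?expR_gt0//.
  have -> : expR t = expR (t / 2) ^+ 2.
    by rewrite -expRM_natl; congr expR; field.
  by rewrite -exprMn lerXn2r ?nnegrE ?CP// ?mulr_ge0 ?expR_ge0 ?(ltW C0)// ltW.
apply: (@integral_le_antiderivative_bound _ f G).
- by move=> t t0; rewrite /f mulr_ge0 ?(ltW K0)// mulr_ge0 ?mulr_ge0 ?powR_ge0 ?(ltW a0)// invr_ge0 (ltW (pa t)).
- move=> t t0.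
  have d1 := is_deriveZ a (is_derive1_powR (a - 1) t0).
  have df := is_deriveZ K (is_deriveM d1 (is_deriveM (dV t t0) (dV t t0))).
  exact: (@is_derive1_continuous _ f t _ df).
- move=> t t0.
  have dc : is_derive t (1 : R) (cst (1 : R)) 0 by exact: is_derive_cst.
  have dG := is_deriveZ K (is_deriveB dc (dV t t0)).
  apply: (@is_derive_eq _ _ _ G t 1 (f t) _ dG).
  by rewrite /GRing.scale/= /f -exprVn; ring.
- move=> t t0; rewrite /G.
  have : (1 + t `^ a)^-1 <= 1 by rewrite invf_le1// lerDl powR_ge0.
  have : 0 < (1 + t `^ a)^-1 by rewrite invr_gt0.
  set u := _^-1 => u0 u1.
  by rewrite mulr_ge0 ?(ltW K0) ?subr_ge0//= ger_pMr// gerBl ltW.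
Qed.

(** Since [fine] sends infinity to 0, finiteness is part of positivity. The lower bound comes from
    [[1, 2]], where [t^(a-1) >= 1/t >= 1/2] and [exp(-t) >= exp(-2)]. *)
Lemma gammaf_gt0 (R : realType) (a : R) : 0 < a -> 0 < gammaf a.
Proof.
move=> a0; apply: fine_gt0; rewrite gammaf_integral_finite// andbT.
pose c : R := expR (- 2) / 2; have c0 : 0 < c by rewrite divr_gt0// expR_gt0.
apply: (@lt_le_trans _ _ (\int[@lebesgue_measure R]_(t in `]0%R, +oo[)
  (c%:E * (\1_`[1, 2] t)%:E))%E).
  rewrite ge0_integralZl//; first 1 last.
  - by apply/measurable_EFinP; exact: measurable_indic.
  - by rewrite lee_fin ltW.
  rewrite integral_indic//= setIidl; last first.
    by move=> t/=; rewrite !in_itv/= => /andP[t1 _]; rewrite andbT; lra.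
  rewrite mule_gt0 ?lte_fin// lebesgue_measure_itv/= lte_fin ltr1n/=.
  by rewrite -EFinB lte_fin; lra.
apply: le_integral_dominated => t; rewrite /= in_itv/= andbT => t0.
  by rewrite -EFinM lee_fin mulr_ge0 ?(ltW c0).
rewrite -EFinM lee_fin indicE; case: (boolP (t \in _)); last first.
  by rewrite mulr0 mulr_ge0 ?powR_ge0 ?expR_ge0.
rewrite inE/= in_itv/= => /andP[t1 t2]; rewrite mulr1 /c mulrC.
apply: ler_pM; rewrite ?expR_ge0 ?invr_ge0 ?ler_expR//; last lra.
rewrite (@le_trans _ _ (t `^ (-1)))//.
  by rewrite powR_inv1 ?(ltW t0)// lef_pV2 ?posrE//.
by rewrite ler_powR//; lra.
Qed.

(** * Quadratic forms and positive definite matrices *)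

Definition qform {R : realType} {r : nat} (A : 'M[R]_r) (v : 'cV[R]_r) : R :=
  (v^T *m A *m v) ord0 ord0.

Definition sqnorm {R : realType} {r : nat} (v : 'cV[R]_r) : R :=
  \sum_i v i ord0 ^+ 2.

Lemma sqnorm_ge0 (R : realType) (r : nat) (v : 'cV[R]_r) : 0 <= sqnorm v.
Proof. by apply: sumr_ge0 => i _; exact: sqr_ge0. Qed.

Lemma tr_mulmx_self (R : realType) (r : nat) (v : 'cV[R]_r) :
  (v^T *m v) ord0 ord0 = sqnorm v.
Proof. by rewrite mxE; apply: eq_bigr => i _; rewrite mxE expr2. Qed.

Lemma qformE (R : realType) (r : nat) (A : 'M[R]_r) (v : 'cV[R]_r) :
  qform A v = \sum_i \sum_j v i ord0 * A i j * v j ord0.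
Proof.
rewrite /qform mxE exchange_big; apply: eq_bigr => j _.
by rewrite mxE mulr_suml; apply: eq_bigr => i _; rewrite mxE.
Qed.

Lemma qformZ (R : realType) (r : nat) (A : 'M[R]_r) (c : R) (v : 'cV[R]_r) :
  qform A (c *: v) = c ^+ 2 * qform A v.
Proof.
rewrite !qformE mulr_sumr; apply: eq_bigr => i _; rewrite mulr_sumr.
by apply: eq_bigr => j _; rewrite !mxE; ring.
Qed.

Lemma qform_ge0 (R : realType) (r : nat) (A : 'M[R]_r) (v : 'cV[R]_r) :
  posdef A -> 0 <= qform A v.
Proof.
move=> [_ A0]; have [->|/A0/ltW//] := eqVneq v 0.
by rewrite /qform mulmx0 mxE.
Qed.

(* The characteristic polynomial of [- A] is monic, has value [\det A] at 0,
   and has no root on [[0, +oo[]. *)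
Lemma posdef_det_gt0 (R : realType) (r : nat) (A : 'M[R]_r) :
  posdef A -> 0 < \det A.
Proof.
move=> [_ A0]; pose p := char_poly (- A).
have p0 : p.[0] = \det A.
  rewrite horner_coef0 char_poly_det -[- A]scaleN1r detZ mulrA -exprD addnn -mul2n.
  by rewrite exprM sqrrN expr1n expr1n mul1r.
(* A row eigenvector [v] of [- A] for [x >= 0] would give [v A v^T = - x |v|^2 <= 0]. *)
have noroot x : 0 <= x -> ~~ root p x.
  move=> x0; rewrite -eigenvalue_root_char; apply/negP => /eigenvalueP[v vA v0].
  have v0' : v^T != 0 by rewrite trmx_eq0.
  have := A0 _ v0'; rewrite trmxK -[v *m A]opprK -mulmxN vA mulNmx -scalemxAl.
  rewrite -{1}[v]trmxK !mxE; have := sqnorm_ge0 v^T; rewrite -tr_mulmx_self mxE.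
  by set q := \sum_(i < r) _ => q0; have := mulr_ge0 x0 q0; lra.
have [b pb] : exists b, forall y, b <= y -> 0 < p.[y].
  have lp : 0 < lead_coef p by rewrite (monicP (char_poly_monic _)).
  have [b pb] := polyrcf.poly_pinfty_gt_lc lp.
  by exists b => y /pb; exact: lt_le_trans.
have b0 : 0 <= Num.max b 0 by rewrite le_max lexx orbT.
rewrite ltNge -p0; apply/negP => p0le.
have [|c /andP[c0 _]] := @poly_ivt _ p 0 (Num.max b 0) b0.
  by rewrite p0le ltW// pb// le_max lexx.
by apply/negP; exact: noroot.
Qed.

Lemma posdef_unitmx (R : realType) (r : nat) (A : 'M[R]_r) :
  posdef A -> A \in unitmx.
Proof. by move=> /posdef_det_gt0 A0; rewrite unitmxE unitfE gt_eqF. Qed.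

(** Substituting [w = A^-1 v] turns [v^T A^-1 v] into [w^T A w]. *)
Lemma posdef_invmx (R : realType) (r : nat) (A : 'M[R]_r) :
  posdef A -> posdef (invmx A).
Proof.
move=> pA; have uA := posdef_unitmx pA; have [sA A0] := pA.
split=> [|v v0]; first by rewrite trmx_inv sA.
have w0 : invmx A *m v != 0.
  by apply: contraNneq v0 => w0; rewrite -(mulKVmx uA v) w0 mulmx0.
by have := A0 _ w0; rewrite trmx_mul trmx_inv sA -!mulmxA mulKVmx.
Qed.

Lemma qformD (R : realType) (r : nat) (A B : 'M[R]_r) (v : 'cV[R]_r) :
  qform (A + B) v = qform A v + qform B v.
Proof. by rewrite /qform mulmxDr mulmxDl mxE. Qed.

(** [B] is only semidefinite so that the rank-one updates of the scale matrix [Xi] are covered. *)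
Lemma posdefD (R : realType) (r : nat) (A B : 'M[R]_r) :
  posdef A -> (B^T = B) -> (forall v, 0 <= qform B v) -> posdef (A + B).
Proof.
move=> [sA A0] sB B0; split=> [|v v0]; first by rewrite linearD/= sA sB.
by rewrite -/(qform _ _) qformD ltr_pwDl ?B0//; exact: A0.
Qed.

Lemma posdefZ (R : realType) (r : nat) (A : 'M[R]_r) (c : R) :
  0 < c -> posdef A -> posdef (c *: A).
Proof.
move=> c0 [sA A0]; split=> [|v v0]; first by rewrite linearZ/= sA.
by rewrite -scalemxAr -scalemxAl mxE mulr_gt0 ?A0.
Qed.

Lemma qformDZ (R : realType) (r : nat) (A : 'M[R]_r) (c : R)
  (u v : 'cV[R]_r) : A^T = A ->
  qform A (u + c *: v) = qform A u + 2 * c * (u^T *m A *m v) ord0 ord0 + c ^+ 2 * qform A v.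
Proof.
move=> sA; have vu : (v^T *m A *m u) ord0 ord0 = (u^T *m A *m v) ord0 ord0.
  transitivity ((v^T *m A *m u)^T ord0 ord0); first by rewrite [RHS]mxE.
  by rewrite !trmx_mul trmxK sA mulmxA.
have -> : qform A (u + c *: v) = qform A u + c * (u^T *m A *m v) ord0 ord0
    + (c * (v^T *m A *m u) ord0 ord0 + c * (c * qform A v)).
  rewrite /qform.
  have -> : (u + c *: v)^T = u^T + c *: v^T by rewrite linearD/= linearZ.
  rewrite !(mulmxDl, mulmxDr) -!(scalemxAl, scalemxAr).
  set a := u^T *m A *m u; set b := u^T *m A *m v; set d := v^T *m A *m u.
  by set e := v^T *m A *m v; rewrite !mxE; ring.
by rewrite vu; ring.
Qed.

(* Cauchy-Schwarz for [A], from [0 <= qform A (v - (b / q) A^-1 u)] with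
   [b = u^T v] and [q = u^T A^-1 u]. *)
Lemma dot_sqr_le_qform (R : realType) (r : nat) (A : 'M[R]_r) (u v : 'cV[R]_r) :
  posdef A ->
  ((u^T *m v) ord0 ord0) ^+ 2 <= qform (invmx A) u * qform A v.
Proof.
move=> pA; have pI := posdef_invmx pA; have [sA _] := pA; have [sI I0] := pI.
have [->|u0] := eqVneq u 0.
  by rewrite trmx0 mul0mx mxE expr0n/= mulr_ge0// qform_ge0.
set q := qform (invmx A) u; have q0 : 0 < q by exact: I0.
set b := (u^T *m v) ord0 ord0.
have : 0 <= qform A (v + (- (b / q)) *: (invmx A *m u)) by exact: qform_ge0.
rewrite qformDZ//.
have -> : (v^T *m A *m (invmx A *m u)) ord0 ord0 = b.
  rewrite -mulmxA mulKVmx ?posdef_unitmx//.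
  transitivity ((v^T *m u)^T ord0 ord0); first by rewrite [RHS]mxE.
  by rewrite trmx_mul trmxK.
have -> : qform A (invmx A *m u) = q.
  by rewrite /q /qform trmx_mul sI -!mulmxA mulKVmx ?posdef_unitmx.
have -> : qform A v + 2 * - (b / q) * b + (- (b / q)) ^+ 2 * q
    = (q * qform A v - b ^+ 2) / q by field; rewrite gt_eqF.
by rewrite pmulr_lge0 ?invr_gt0// subr_ge0.
Qed.

(** Cauchy-Schwarz against the basis vectors bounds each [v_i^2] by the [i]-th diagonal entry of
    [A^-1] times [qform A v]. So [e] is the inverse of one plus the trace of [A^-1]; the one keeps
    it defined for [r = 0]. *)
Lemma sqnorm_le_qform (R : realType) (r : nat) (A : 'M[R]_r) : posdef A ->
  exists2 e : R, 0 < e & forall v, e * sqnorm v <= qform A v.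
Proof.
move=> pA; pose M := 1 + \sum_i qform (invmx A) (delta_mx i ord0).
have M0 : 0 < M.
  by rewrite ltr_pwDl// sumr_ge0// => i _; apply: qform_ge0; exact: posdef_invmx.
exists M^-1; first by rewrite invr_gt0.
move=> v; rewrite mulrC ler_pdivrMr//.
have : sqnorm v <= \sum_i qform (invmx A) (delta_mx i ord0) * qform A v.
  apply: ler_sum => i _; have := dot_sqr_le_qform (delta_mx i ord0) v pA.
  rewrite (_ : _ ord0 ord0 = v i ord0)//; rewrite mxE (bigD1 i)//= !mxE !eqxx mul1r.
  by rewrite big1 ?addr0// => j ji; rewrite !mxE (negbTE ji) mul0r.
move=> h; apply: le_trans h _; rewrite -mulr_suml mulrC ler_wpM2l ?qform_ge0//.
by rewrite lerDr.
Qed.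

Lemma qform_le_sqnorm (R : realType) (r : nat) (A : 'M[R]_r) :
  exists2 M : R, 0 < M & forall v, qform A v <= M * sqnorm v.
Proof.
exists (1 + \sum_i \sum_j `|A i j|) => [|v].
  by rewrite ltr_pwDl// sumr_ge0// => i _; rewrite sumr_ge0.
have vi i : v i ord0 ^+ 2 <= sqnorm v.
  by rewrite /sqnorm (bigD1 i)//= lerDl sumr_ge0// => j _; exact: sqr_ge0.
rewrite mulrDl mul1r ler_wpDl ?sqnorm_ge0// qformE mulr_suml.
apply: ler_sum => i _; rewrite mulr_suml; apply: ler_sum => j _.
apply: le_trans (ler_norm _) _; rewrite mulrAC normrM mulrC ler_wpM2l//.
rewrite normrM; have := vi i; have := vi j.
rewrite -[v i ord0 ^+ 2]real_normK ?num_real// -[v j ord0 ^+ 2]real_normK ?num_real//.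
by have := sqr_ge0 (`|v i ord0| - `|v j ord0|); nra.
Qed.

Lemma sqnormD_le (R : realType) (r : nat) (u v : 'cV[R]_r) :
  sqnorm (u + v) <= 2 * sqnorm u + 2 * sqnorm v.
Proof.
rewrite !mulr_sumr -big_split/=; apply: ler_sum => i _; rewrite mxE.
by have := sqr_ge0 (u i ord0 - v i ord0); nra.
Qed.

Lemma mahalE (R : realType) (r : nat) (S : 'M[R]_r) (m y : 'cV[R]_r) :
  mahal S m y = qform (invmx S) (y - m).
Proof. by []. Qed.

(** With its converse [mahal_le_sqnorm], this makes decay rates independent of centre and scale. The
    shift is absorbed by [|v|^2 <= 2 |v - m|^2 + 2 |m|^2]. *)
Lemma sqnorm_le_mahal (R : realType) (r : nat) (S : 'M[R]_r) (m : 'cV[R]_r) :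
  posdef S -> exists2 c : R, 0 < c &
    forall v, 1 + sqnorm v <= c * (1 + mahal S m v).
Proof.
move=> /posdef_invmx pS; have [e e0 eP] := sqnorm_le_qform pS.
have s0 := sqnorm_ge0 m; have ei0 : 0 < e^-1 by rewrite invr_gt0.
exists (1 + 2 * sqnorm m + 2 * e^-1) => [|v]; first by lra.
have := sqnormD_le (v - m) m; rewrite subrK => h1.
have := eP (v - m); rewrite -mahalE mulrC -ler_pdivlMr// mulrC => h2.
have q0 : 0 <= mahal S m v by exact: qform_ge0.
have := mulr_ge0 s0 q0; lra.
Qed.

Lemma mahal_le_sqnorm (R : realType) (r : nat) (S : 'M[R]_r) (m : 'cV[R]_r) :
  exists2 c : R, 0 < c & forall v, 1 + mahal S m v <= c * (1 + sqnorm v).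
Proof.
have [M M0 MP] := qform_le_sqnorm (invmx S).
have s0 := sqnorm_ge0 (- m).
exists (1 + 2 * M + 2 * M * sqnorm (- m)) => [|v].
  by have := mulr_ge0 (ltW M0) s0; lra.
have h1 := sqnormD_le v (- m).
have := MP (v - m); rewrite -mahalE => h2.
have v0 := sqnorm_ge0 v.
have := ler_wpM2l (ltW M0) h1.
have := mulr_ge0 (mulr_ge0 (ltW M0) s0) v0.
by nra.
Qed.

(** * Power decay, integrability and the abstract importance sampling bound *)

Definition decays {R : realType} {r : nat} (s : R) (f : 'cV[R]_r -> R) : Prop :=
  exists2 K : R, 0 <= K & forall v, f v <= K * (1 + sqnorm v) `^ (- s).

(** Each [1 + v_i^2] is at most [1 + |v|^2], so the radial power is dominated by a product of
    one-dimensional powers, whose iterated integral factorises. *)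
Lemma decays_iint (R : realType) (r : nat) (s : R) (f : 'cV[R]_r -> R) :
  r%:R / 2 < s -> (forall v, 0 <= f v) -> decays s f ->
  (iint (fun v => (f v)%:E) < +oo)%E.
Proof.
move=> rs f0 [K K0 fK].
(* [p > 1/2] and [r p <= s]; dividing by [r + 1] covers [r = 0]. *)
pose p := 2^-1 + (s - r%:R / 2) / r.+1%:R.
have r1 : 0 < r.+1%:R :> R by [].
have sr0 : 0 < s - r%:R / 2 by rewrite subr_gt0.
have p12 : 2^-1 < p by rewrite /p ltrDl divr_gt0.
have p0 : 0 <= p by lra.
have rps : p * r%:R <= s.
  have -> : p * r%:R = r%:R / 2 + (s - r%:R / 2) * (r%:R / r.+1%:R).
    by rewrite /p; field; rewrite gt_eqF.
  have : r%:R / r.+1%:R <= 1 :> R by rewrite ler_pdivrMr// mul1r ler_nat.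
  have : 0 <= r%:R / r.+1%:R :> R by rewrite divr_ge0.
  by set u := r%:R / r.+1%:R => u0 u1; nra.
have [I hI] := integral_powR_oneDsqr_finite p12.
have le_prod v : (1 + sqnorm v) `^ (- s) <= \prod_(i < r) (1 + v i ord0 ^+ 2) `^ (- p).
  have v1 : 1 <= 1 + sqnorm v by rewrite lerDl sqnorm_ge0.
  apply: (@le_trans _ _ ((1 + sqnorm v) `^ (- p * r%:R))).
    by rewrite ler_powR// mulNr lerN2.
  rewrite powRrM powR_mulrn ?powR_ge0// -[r in _ ^+ r]card_ord -prodr_const.
  apply: ler_prod => i _; rewrite powR_ge0/=.
  have v0 : 0 < 1 + sqnorm v by lra.
  have vi0 : 0 < 1 + v i ord0 ^+ 2 by rewrite ltr_pwDl ?sqr_ge0.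
  rewrite !powRN lef_pV2 ?posrE ?powR_gt0//.
  have vi : v i ord0 ^+ 2 <= sqnorm v.
    by rewrite /sqnorm (bigD1 i)//= lerDl sumr_ge0// => j _; exact: sqr_ge0.
  by apply: ge0_ler_powR; rewrite ?nnegrE//; lra.
apply: (@le_lt_trans _ _ (K * I ^+ r)%:E); last by rewrite ltry.
rewrite -(iint_prod (h := fun t => (1 + t ^+ 2) `^ (- p)))//; last 2 first.
- by move=> t; exact: powR_ge0.
- by apply: continuous_measurable_fun; exact: continuous_powR_oneDsqr.
apply: le_iint => v; rewrite lee_fin//.
by apply: le_trans (fK v) _; rewrite ler_wpM2l.
Qed.

(** Since [phat] and its mean [m] are nonnegative, [(phat - m)^2 <= phat^2 + m^2]; the variance
    integrand is thus at most [psi^2 / phi + m^2 phi]. The indicator of [C] enters only through its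
    values 0 and 1. *)
Lemma importance_sampling (R : realType) (r : nat) (C : set 'cV[R]_r) (s : R)
  (phi psi : 'cV[R]_r -> R) :
  r%:R / 2 < s -> (forall v, 0 < phi v) -> (forall v, 0 <= psi v) ->
  decays s phi -> decays s psi -> decays s (fun v => psi v ^+ 2 / phi v) ->
  is_mean C phi psi = post_prob C psi /\ (is_var C phi psi < +oo)%E.
Proof.
move=> rs phi0 psi0 [K1 K10 phiK] psiD [K2 K20 ratK].
have meanE : is_mean C phi psi = post_prob C psi.
  apply: eq_iint => v; congr EFin.
  by rewrite /phat -mulrA divfK// gt_eqF.
have I1 v : \1_C v = 0 :> R \/ \1_C v = 1 :> R.
  by rewrite indicE; case: (_ \in _); [right|left].
split=> //; have mfin : (post_prob C psi < +oo)%E.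
  apply: le_lt_trans (decays_iint rs psi0 psiD).
  by apply: le_iint => v; rewrite lee_fin; case: (I1 v) => ->; rewrite ?mul0r ?mul1r.
have m0 : (0 <= post_prob C psi)%E.
  by apply: iint_ge0 => v; rewrite lee_fin mulr_ge0.
(* The mean is finite, so the extended-real integrand is that of a real function. *)
rewrite /is_var meanE -[post_prob C psi]fineK ?ge0_fin_numE//.
set m := fine _; have {}m0 : 0 <= m by exact: fine_ge0.
apply: (@decays_iint _ _ s (fun v => (phat C phi psi v - m) ^+ 2 * phi v)) => //.
  by move=> v; rewrite mulr_ge0 ?sqr_ge0 ?ltW.
exists (K2 + m ^+ 2 * K1) => [|v].
  by rewrite addr_ge0// mulr_ge0// sqr_ge0.
have rat0 : 0 <= psi v ^+ 2 / phi v by rewrite divr_ge0 ?sqr_ge0 ?ltW.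
have phatE : phat C phi psi v ^+ 2 * phi v <= psi v ^+ 2 / phi v.
  rewrite /phat; case: (I1 v) => ->; first by rewrite mul0r expr0n/= mul0r.
  by rewrite mul1r expr_div_n [phi v ^+ 2]expr2 invfM mulrA divfK// gt_eqF.
have phat0 : 0 <= phat C phi psi v.
  by rewrite /phat mulr_ge0// divr_ge0// ltW.
apply: (@le_trans _ _ (phat C phi psi v ^+ 2 * phi v + m ^+ 2 * phi v)).
  rewrite -mulrDl ler_wpM2r ?(ltW (phi0 v))//; have := mulr_ge0 phat0 m0; nra.
rewrite mulrDl; apply: lerD; first exact: le_trans phatE (ratK v).
by rewrite -[leRHS]mulrA ler_wpM2l ?sqr_ge0.
Qed.

(** * Gaussian densities *)

Lemma expR_mahal_decays (R : realType) (r : nat) (S : 'M[R]_r) (m : 'cV[R]_r)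
  (s e c : R) : posdef S -> 0 < s -> 0 < e -> 0 <= c ->
  decays s (fun v => c * expR (- (e * mahal S m v))).
Proof.
move=> pS s0 e0 c0; have [k k0 kP] := sqnorm_le_mahal m pS.
have [K K0 KP] := powR_le_expR s0 e0.
exists (c * (k `^ s * K)) => [|v].
  by rewrite mulr_ge0// mulr_ge0 ?powR_ge0// ltW.
rewrite -mulrA ler_wpM2l// expRN powRN.
have v1 : 0 < 1 + sqnorm v by rewrite ltr_pwDl// sqnorm_ge0.
have q0 : 0 <= mahal S m v by apply: qform_ge0; exact: posdef_invmx.
rewrite ler_pdivlMr ?powR_gt0// mulrC ler_pdivrMr ?expR_gt0// -mulrA.
apply: le_trans (ler_wpM2l (powR_ge0 _ _) (KP _ q0)).
rewrite -powRM ?(ltW k0)//; last lra.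
apply: ge0_ler_powR; rewrite ?nnegrE; [exact: ltW|exact: ltW| |exact: kP].
by rewrite mulr_ge0 ?(ltW k0)//; lra.
Qed.

Lemma decays_le (R : realType) (r : nat) (s : R) (f g : 'cV[R]_r -> R) :
  (forall v, f v <= g v) -> decays s g -> decays s f.
Proof. by move=> fg [K K0 gK]; exists K => // v; exact: le_trans (gK v). Qed.

Definition gauss_const {R : realType} {r : nat} (S : 'M[R]_r) : R :=
  powR (pi *+ 2) (- (r%:R / 2)) * (Num.sqrt (\det S))^-1.

Lemma gauss_const_gt0 (R : realType) (r : nat) (S : 'M[R]_r) :
  posdef S -> 0 < gauss_const S.
Proof.
move=> /posdef_det_gt0 d0; rewrite mulr_gt0 ?invr_gt0 ?sqrtr_gt0//.
by rewrite powR_gt0// mulrn_wgt0// pi_gt0.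
Qed.

Lemma gauss_pdfE (R : realType) (r : nat) (m : 'cV[R]_r) (S : 'M[R]_r) v :
  gauss_pdf m S v = gauss_const S * expR (- (2^-1 * mahal S m v)).
Proof. by rewrite /gauss_pdf [2^-1 * _]mulrC. Qed.

(** The exponent of [psi^2 / phi] is [- q_T(v - b) + q_S(v - a) / 2], with [q_S], [q_T] the
    precision forms. Replacing [q_T] by the smaller [q_S] leaves coefficient 1 against 1/2, so
    moving the centre costs only a constant factor. *)
Lemma gauss_importance (R : realType) (r : nat) (C : set 'cV[R]_r)
  (S T : 'M[R]_r) (a b : 'cV[R]_r) : posdef S -> posdef T ->
  (forall v, qform (invmx S) v <= qform (invmx T) v) ->
  let phi := gauss_pdf a S in let psi := gauss_pdf b T in
  is_mean C phi psi = post_prob C psi /\ (is_var C phi psi < +oo)%E.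
Proof.
move=> pS pT ST phi psi; have cS := gauss_const_gt0 pS; have cT := gauss_const_gt0 pT.
have h0 : 0 < 2^-1 :> R by rewrite invr_gt0.
have q0 : 0 < 4^-1 :> R by rewrite invr_gt0.
(* Gaussians beat every power; [r + 1] is one convenient exponent above [r/2]. *)
have s0 : 0 < r%:R + 1 :> R by rewrite ltr_wpDl.
have phi0 v : 0 < phi v by rewrite /phi gauss_pdfE mulr_gt0// expR_gt0.
have psi0 v : 0 < psi v by rewrite /psi gauss_pdfE mulr_gt0// expR_gt0.
apply: (@importance_sampling _ _ _ (r%:R + 1)) => //.
- have := ler0n R r; lra.
- by move=> v; exact: ltW.
- apply: decays_le (expR_mahal_decays a pS s0 h0 (ltW cS)) => v.
  by rewrite /phi gauss_pdfE.
- apply: decays_le (expR_mahal_decays b pT s0 h0 (ltW cT)) => v.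
  by rewrite /psi gauss_pdfE.
have [sI _] := posdef_invmx pS.
pose y := b - a; pose c := gauss_const T ^+ 2 / gauss_const S * expR (3 / 2 * qform (invmx S) y).
have c0 : 0 <= c by rewrite mulr_ge0 ?expR_ge0// divr_ge0 ?sqr_ge0// ltW.
apply: decays_le (expR_mahal_decays b pS s0 q0 c0) => v.
rewrite /phi /psi !gauss_pdfE exprMn -expRM_natl invfM -expRN opprK.
have -> : c * expR (- (4^-1 * mahal S b v)) = gauss_const T ^+ 2 / gauss_const S *
    expR (3 / 2 * qform (invmx S) y - 4^-1 * mahal S b v).
  by rewrite /c -mulrA -expRD.
rewrite mulrACA -expRD ler_wpM2l//; first by rewrite divr_ge0 ?sqr_ge0// ltW.
rewrite ler_expR.
have h1 : mahal S b v <= mahal T b v := ST (v - b).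
(* Young: [q (x + y) <= 3/2 q x + 3 q y] with [x = v - b], so that
   [q x - q (x + y) / 2 >= q x / 4 - 3/2 q y]. *)
have : 0 <= qform (invmx S) ((v - b) + (- 2) *: y).
  by apply: qform_ge0; exact: posdef_invmx.
have : mahal S a v = qform (invmx S) ((v - b) + 1 *: y).
  by rewrite mahalE scale1r /y addrA subrK.
rewrite !qformDZ// -![qform _ (v - b)]mahalE => ->; lra.
Qed.

(** * Student densities *)

(** The lower bound is needed as well, because [phi] is the denominator of [psi^2 / phi]. *)
Lemma student_bounds (R : realType) (r : nat) (nu : R) (m : 'cV[R]_r) (S : 'M[R]_r) :
  0 < nu -> posdef S -> exists k K : R, [/\ 0 < k, 0 < K & forall v,
    k * (1 + sqnorm v) `^ (- ((nu + r%:R) / 2)) <= student_pdf nu m S v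
    <= K * (1 + sqnorm v) `^ (- ((nu + r%:R) / 2))].
Proof.
move=> nu0 pS; set s := (nu + r%:R) / 2.
have s0 : 0 < s by rewrite divr_gt0// ltr_pwDl.
rewrite /student_pdf -/s; set c := gammaf s / _.
have c0 : 0 < c.
  rewrite divr_gt0 ?gammaf_gt0// !mulr_gt0 ?gammaf_gt0 ?divr_gt0//.
    by rewrite powR_gt0// mulr_gt0// pi_gt0.
  by rewrite sqrtr_gt0 posdef_det_gt0.
move: c c0 => c c0.
have [k1 k10 k1P] := sqnorm_le_mahal m pS.
have [k2 k20 k2P] := mahal_le_sqnorm S m.
have ni : 0 < nu^-1 by rewrite invr_gt0.
(* From [1 + q/nu <= (1 + 1/nu) (1 + q)] and [1 + q <= (1 + nu) (1 + q/nu)] for the Mahalanobis form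
   [q]; the negative exponent [- s] reverses both comparisons. *)
exists (c * ((1 + nu^-1) * k2) `^ (- s)), (c * (((1 + nu) * k1)^-1) `^ (- s)).
have a0 : 0 < (1 + nu^-1) * k2 by rewrite mulr_gt0// ltr_pwDl// ltW.
have b0 : 0 < (1 + nu) * k1 by rewrite mulr_gt0// ltr_pwDl// ltW.
split=> [||v]; [by rewrite mulr_gt0// powR_gt0| |].
  by rewrite mulr_gt0// powR_gt0// invr_gt0.
have v1 : 0 < 1 + sqnorm v by rewrite ltr_pwDl// sqnorm_ge0.
have q0 : 0 <= mahal S m v by apply: qform_ge0; exact: posdef_invmx.
have qn0 : 0 <= mahal S m v / nu by rewrite divr_ge0// ltW.
have mono (x y : R) : 0 < x -> x <= y -> y `^ (- s) <= x `^ (- s).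
  move=> x0 xy; have y0 := lt_le_trans x0 xy.
  rewrite !powRN lef_pV2 ?posrE ?powR_gt0//.
  by apply: ge0_ler_powR; rewrite ?nnegrE// ltW.
rewrite -!mulrA !ler_pM2l// -!powRM ?invr_ge0 ?(ltW a0) ?(ltW b0) ?(ltW v1)//.
apply/andP; split; apply: mono.
- lra.
- apply: (@le_trans _ _ ((1 + nu^-1) * (1 + mahal S m v))).
    have -> : (1 + nu^-1) * (1 + mahal S m v)
      = 1 + mahal S m v / nu + (nu^-1 + mahal S m v) by ring.
    by rewrite lerDl; lra.
  by rewrite -mulrA ler_wpM2l//; lra.
- by rewrite mulr_gt0// invr_gt0.
- rewrite mulrC ler_pdivrMr//; apply: le_trans (k1P v) _.
  rewrite [leRHS]mulrA [leRHS]mulrC ler_wpM2l ?(ltW k10)//.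
  have -> : (1 + mahal S m v / nu) * (1 + nu)
      = 1 + mahal S m v + (nu + mahal S m v / nu) by field; rewrite gt_eqF.
  by rewrite lerDl; lra.
Qed.

(** Let [w] be the power matching [phi]. As [nu <= nu'], [psi] decays at least as fast as [w], so
    [psi^2 / phi] is again of order [w], which is integrable because [nu > 0]. *)
Lemma student_importance (R : realType) (r : nat) (C : set 'cV[R]_r)
  (nu nu' : R) (a b : 'cV[R]_r) (S T : 'M[R]_r) :
  0 < nu -> nu <= nu' -> posdef S -> posdef T ->
  let phi := student_pdf nu a S in let psi := student_pdf nu' b T in
  is_mean C phi psi = post_prob C psi /\ (is_var C phi psi < +oo)%E.
Proof.
move=> nu0 nunu' pS pT phi psi.
have [k [K [k0 K0 phiP]]] := student_bounds a nu0 pS.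
have [k' [K' [k'0 K'0 psiP]]] := student_bounds b (lt_le_trans nu0 nunu') pT.
pose s := (nu + r%:R) / 2; pose w (v : 'cV[R]_r) := (1 + sqnorm v) `^ (- s).
have w0 v : 0 < w v by rewrite powR_gt0// ltr_pwDl// sqnorm_ge0.
have phi_ge v : k * w v <= phi v by have /andP[] := phiP v.
have phi_le v : phi v <= K * w v by have /andP[] := phiP v.
have phi0 v : 0 < phi v by apply: lt_le_trans (phi_ge v); rewrite mulr_gt0.
have psi0 v : 0 <= psi v.
  have /andP[+ _] := psiP v; apply: le_trans; rewrite mulr_ge0 ?powR_ge0//.
  exact: ltW.
have psi_le v : psi v <= K' * w v.
  have /andP[_ h] := psiP v; apply: le_trans h _; rewrite ler_wpM2l ?(ltW K'0)//.
  by rewrite ler_powR ?lerDl ?sqnorm_ge0// /s; lra.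
apply: (@importance_sampling _ _ _ s) => //.
- by rewrite /s; lra.
- by exists K => //; exact: ltW.
- by exists K' => //; exact: ltW.
exists (K' ^+ 2 / k) => [|v]; first by rewrite divr_ge0 ?sqr_ge0// ltW.
rewrite ler_pdivrMr//.
apply: (@le_trans _ _ ((K' * w v) ^+ 2)).
  by rewrite lerXn2r ?nnegrE// mulr_ge0// ltW.
apply: (@le_trans _ _ (K' ^+ 2 / k * w v * (k * w v))).
  by rewrite [leRHS](_ : _ = (K' * w v) ^+ 2)//; field; rewrite gt_eqF.
by rewrite ler_wpM2l// mulr_ge0 ?(ltW (w0 v))// divr_ge0 ?sqr_ge0// ltW.
Qed.

(** * Posterior parameters under the updates, and the theorem *)

Lemma post_known_posdef (R : realType) (r : nat) (Gam Lam0 : 'M[R]_r)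
  (mu0 : 'cV[R]_r) (y : nat -> 'cV[R]_r) (k : nat) :
  posdef Gam -> posdef Lam0 -> posdef (post_known Gam Lam0 mu0 y k).1.
Proof.
move=> pG pL; elim: k => [//|k] /=.
case: (post_known _ _ _ _ _) => L m /= IH; apply: posdef_invmx.
have pGi := posdef_invmx pG.
apply: posdefD (posdef_invmx IH) _ _; first by case: pGi.
by move=> v; exact: qform_ge0.
Qed.

(** Each observation adds the positive definite [invmx Gam] to the precision. *)
Lemma post_known_precision_le (R : realType) (r : nat) (Gam Lam0 : 'M[R]_r)
  (mu0 : 'cV[R]_r) (y : nat -> 'cV[R]_r) (n l : nat) (v : 'cV[R]_r) :
  posdef Gam -> posdef Lam0 ->
  qform (invmx (post_known Gam Lam0 mu0 y n).1) v <=
  qform (invmx (post_known Gam Lam0 mu0 y (n + l)).1) v.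
Proof.
move=> pG pL; elim: l => [|l IH]; first by rewrite addn0.
apply: le_trans IH _; rewrite addnS /=.
case: (post_known _ _ _ _ _) => L m /=; rewrite invmxK qformD lerDl.
by apply: qform_ge0; exact: posdef_invmx.
Qed.

(** Only the degrees of freedom are tracked exactly, since they must be compared between [n] and
    [n + l]. The increment of [Xi] is semidefinite because [v^T u u^T v = (u^T v)^2]. *)
Lemma post_niw_params (R : realType) (r : nat) (mu0 : 'cV[R]_r) (kap0 ups0 : R)
  (Xi0 : 'M[R]_r) (y : nat -> 'cV[R]_r) (k : nat) : 0 < kap0 -> posdef Xi0 ->
  exists m ka X, [/\ post_niw mu0 kap0 ups0 Xi0 y k = (m, ka, ups0 + k%:R, X),
    0 < ka & posdef X].
Proof.
move=> k0 pX; elim: k => [|k [m [ka [X [/= -> ka0 pXk]]]]].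
  by exists mu0, kap0, Xi0; rewrite addr0.
do 3 eexists; split; first by rewrite -addrA natr1.
  by rewrite ltr_wpDl// ltW.
set u := _ - _; apply: posdefD => [//||v].
  by rewrite linearZ/= trmx_mul trmxK.
rewrite /qform -scalemxAr -scalemxAl mxE mulr_ge0 ?divr_ge0 ?addr_ge0 ?(ltW ka0)//.
have -> : v^T *m (u *m u^T) *m v = (u^T *m v)^T *m (u^T *m v).
  by rewrite trmx_mul trmxK !mulmxA.
by rewrite tr_mulmx_self sqnorm_ge0.
Qed.

Unset Implicit Arguments.

Theorem theorem2 (R : realType) (d r : nat) (x : 'I_r -> 'cV[R]_d) :
  (* known-covariance model *)
  (forall (Gam Lam0 : 'M[R]_r) (mu0 : 'cV[R]_r) (y : nat -> 'cV[R]_r) (n l : nat),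
     posdef Gam -> posdef Lam0 -> (1 <= l)%N ->
     let phi_n := known_post_pdf Gam Lam0 mu0 y n in
     let phi_nl := known_post_pdf Gam Lam0 mu0 y (n + l) in
     let C := convex_vectors x in
     is_mean C phi_n phi_nl = post_prob C phi_nl
     /\ (is_var C phi_n phi_nl < +oo)%E) /\
  (* unknown-covariance model *)
  (forall (mu0 : 'cV[R]_r) (kap0 ups0 : R) (Xi0 : 'M[R]_r) (y : nat -> 'cV[R]_r)
          (n l : nat),
     0 < kap0 -> r%:R - 1 < ups0 -> posdef Xi0 -> (1 <= l)%N ->
     let phi_n := niw_post_pdf mu0 kap0 ups0 Xi0 y n in
     let phi_nl := niw_post_pdf mu0 kap0 ups0 Xi0 y (n + l) in
     let C := convex_vectors x in
     is_mean C phi_n phi_nl = post_prob C phi_nl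
     /\ (is_var C phi_n phi_nl < +oo)%E).

Proof.
split=> [Gam Lam0 mu0 y n l pG pL _ | mu0 kap0 ups0 Xi0 y n l kap0_gt0 ups0_gt pXi _].
  apply: gauss_importance; [exact: post_known_posdef..|].
  by move=> v; exact: post_known_precision_le.
rewrite /niw_post_pdf.
have [a [ka [X [-> ka0 pX]]]] := post_niw_params mu0 ups0 y n kap0_gt0 pXi.
have [b [kb [Y [-> kb0 pY]]]] := post_niw_params mu0 ups0 y (n + l) kap0_gt0 pXi.
have n0 : 0 <= n%:R :> R by [].
have nl : n%:R <= (n + l)%:R :> R by rewrite ler_nat leq_addr.
(* [r - 1 < ups0] says that the degrees of freedom are positive before any data; each observation
   adds one. *)
have nu0 : 0 < ups0 + n%:R - r%:R + 1 by lra.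
apply: student_importance => //; first by lra.
  by apply: posdefZ pX; rewrite invr_gt0 mulr_gt0.
by apply: posdefZ pY; rewrite invr_gt0 mulr_gt0//; lra.
Qed.
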